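(* Let $\mathcal{V}$ be a variety (of algebras of type $\Omega$) defined by a set of linear regular identities, and let $X$ be a set. The $\emptyset$-extended power algebra $(\mathcal{P}^{<\omega}F_{\mathcal{V}}(X),\Omega,\cup,\emptyset)$ is free over $X$ (with $x\in X$ identified with $\{x\}$) in the variety $\mathcal{S}_{\mathcal{V}}^0$ of all $0$-semilattice ordered $\mathcal{V}$-algebras.
   Context: Fix a finitary type $\tau\colon\Omega\to\mathbb{N}^+$ (all operations have positive arity; $\Omega$ may be infinite). A term is linear if every variable occurs in it at most once; an identity $t\approx u$ is linear if both $t$ and $u$ are linear, and regular if the sets of variables occurring in $t$ and in $u$ are equal. $(F_{\mathcal{V}}(X),\Omega)$ is the free algebra over $X$ in $\mathcal{V}$ (there are no constants, so it is empty if $X=\emptyset$). A $0$-semilattice ordered $\mathcal{V}$-algebra is an algebra $(A,\Omega,+,0)$ with $(A,\Omega)\in\mathcal{V}$, $(A,+)$ a (join) semilattice with least element $0$ (with order $x\le y\Leftrightarrow x+y=y$), each $\omega\in\Omega$ distributing over $+$ in each argument ($\omega(x_1,\ldots,x_i+y_i,\ldots,x_n)=\omega(x_1,\ldots,x_i,\ldots,x_n)+\omega(x_1,\ldots,y_i,\ldots,x_n)$), and $\omega(x_1,\ldots,x_n)=0$ for each $\omega\in\Omega$ whenever some $x_i=0$. $\mathcal{P}^{<\omega}B$ is the set of all finite subsets of $B$ (including $\emptyset$), with complex operations $\omega(B_1,\ldots,B_n)=\{\omega(b_1,\ldots,b_n)\mid b_i\in B_i\}$ (which is $\emptyset$ if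 some $B_i=\emptyset$) and set union $\cup$. *)

(* Defs.v *)
From mathcomp Require Import all_boot.
From mathcomp Require Import boolp classical_sets functions cardinality.
Set Implicit Arguments.
Unset Strict Implicit.
Unset Printing Implicit Defensive.
Local Open Scope classical_set_scope.

(* A type of algebras: a possibly infinite family of operation symbols, each
   of positive finite arity. *)
Record signature := Signature {
  symbol :> Type;
  arity : symbol -> nat;
  arity_gt0 : forall w, 0 < arity w }.

Record algebra (S : signature) := Algebra {
  carrier :> Type;
  opn : forall w : S, ('I_(arity w) -> carrier) -> carrier }.

Definition is_hom (S : signature) (A B : algebra S) (h : A -> B) : Prop :=
  forall (w : S) (a : 'I_(arity w) -> A), h (opn a) = opn (fun i => h (a i)).

(* Terms; the variables are indexed by nat, which is enough to write any
   identity. *)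
Inductive term (S : signature) :=
| Var of nat
| App (w : S) of 'I_(arity w) -> term S.
Arguments Var {S}.

Fixpoint eval (S : signature) (A : algebra S) (v : nat -> A) (t : term S) : A :=
  match t with
  | Var x => v x
  | App w ts => opn (fun i => eval v (ts i))
  end.

Fixpoint occ (S : signature) (x : nat) (t : term S) : nat :=
  match t with
  | Var y => (x == y : nat)
  | App w ts => \sum_(i < arity w) occ x (ts i)
  end.

Definition linear_term (S : signature) (t : term S) : Prop :=
  forall x, occ x t <= 1.

Definition vars (S : signature) (t : term S) : set nat :=
  [set x | 0 < occ x t].

(* The pair e stands for the identity e.1 ~ e.2. *)
Definition identity (S : signature) : Type := (term S * term S)%type.

Definition linear_identity (S : signature) (e : identity S) : Prop :=
  linear_term e.1 /\ linear_term e.2.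

Definition regular_identity (S : signature) (e : identity S) : Prop :=
  vars e.1 = vars e.2.

Definition variety (S : signature) (E : set (identity S)) (A : algebra S) :
    Prop :=
  forall e, E e -> forall v : nat -> A, eval v e.1 = eval v e.2.

(* Classes of algebras are plain predicates rather than classical sets: set is
   universe monomorphic, so using it both for a class of algebras and inside
   the carrier of an algebra (as in fin_subset) is a universe inconsistency.
   The map eta plays the role of the inclusion of X in the free algebra; its
   injectivity is not part of the definition, since it fails for the trivial
   variety. *)
Definition is_free (S : signature) (V : algebra S -> Prop) (X : Type)
    (F : algebra S) (eta : X -> F) : Prop :=
  V F /\
  forall A : algebra S, V A -> forall f : X -> A,
    exists! h : F -> A, is_hom h /\ forall x, h (eta x) = f x.

(* Algebras (A, Omega, +, 0), with no axioms imposed on + and 0 yet. *)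
Record algebra0 (S : signature) := Algebra0 {
  reduct :> algebra S;
  add : reduct -> reduct -> reduct;
  zero : reduct }.
Arguments zero {S} a.

Definition is_hom0 (S : signature) (A B : algebra0 S) (h : A -> B) : Prop :=
  [/\ is_hom h, {morph h : x y / add x y} & h (zero A) = zero B].

Definition sle (S : signature) (A : algebra0 S) (x y : A) : Prop := add x y = y.

(* [eta a with i |-> b] is the tuple a with its i-th entry replaced by b. *)
Definition distributive_ops (S : signature) (A : algebra0 S) : Prop :=
  forall (w : S) (a : 'I_(arity w) -> A) (i : 'I_(arity w)) (b : A),
    opn [eta a with i |-> add (a i) b] =
    add (opn a) (opn [eta a with i |-> b]).

Definition absorbing_ops (S : signature) (A : algebra0 S) : Prop :=
  forall (w : S) (a : 'I_(arity w) -> A) (i : 'I_(arity w)),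
    a i = zero A -> opn a = zero A.

Definition semilattice_ordered0 (S : signature) (V : algebra S -> Prop)
    (A : algebra0 S) : Prop :=
  [/\ V A,
      [/\ associative (@add S A), commutative (@add S A)
        & idempotent_op (@add S A)],
      forall x : A, sle (zero A) x,
      distributive_ops A
    & absorbing_ops A].

Definition is_free0 (S : signature) (K : algebra0 S -> Prop) (X : Type)
    (F : algebra0 S) (eta : X -> F) : Prop :=
  K F /\
  forall A : algebra0 S, K A -> forall f : X -> A,
    exists! h : F -> A, is_hom0 h /\ forall x, h (eta x) = f x.

Definition fin_subset (T : Type) : Type := {B : set T | finite_set B}.

Definition complex_op (S : signature) (A : algebra S) (w : S)
    (B : 'I_(arity w) -> set A) : set A :=
  [set y | exists2 b : 'I_(arity w) -> A, forall i, B i (b i) & opn b = y].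

Lemma finite_complex_op (S : signature) (A : algebra S) (w : S)
    (B : 'I_(arity w) -> set A) :
  (forall i, finite_set (B i)) -> finite_set (complex_op B).
Proof.
move=> finB.
have /choice[s sP] : forall i, exists s : seq {classic A}, B i = [set` s].
  by move=> i; apply/(@finite_seqP {classic A}).
pose g (f : {dffun forall i, seq_sub (s i)}) : A :=
  opn (fun i => ssval (f i) : A).
apply: (@sub_finite_set _ _ (g @` setT)); last first.
  exact/finite_image/finite_finset.
move=> _ [b Bb <-].
have sb i : (b i : {classic A}) \in s i by have := Bb i; rewrite sP.
exists (finfun (fun i => SeqSub (sb i))) => //.
by rewrite /g; congr opn; apply/funext => i; rewrite ffunE.
Qed.

Definition power_opn (S : signature) (A : algebra S) (w : S)
    (B : 'I_(arity w) -> fin_subset A) : fin_subset A :=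
  exist _ (complex_op (fun i => sval (B i)))
    (finite_complex_op (fun i => svalP (B i))).

Lemma finite_union (T : Type) (B C : fin_subset T) :
  finite_set (sval B `|` sval C).
Proof. by rewrite finite_setU; split; exact: svalP. Qed.

Definition power_algebra (S : signature) (A : algebra S) : algebra0 S :=
  @Algebra0 S (Algebra (@power_opn S A))
    (fun B C => exist _ (sval B `|` sval C) (finite_union B C))
    (exist _ set0 (finite_set0 A)).

Definition sing (S : signature) (A : algebra S) (a : A) : power_algebra A :=
  exist _ [set a] (finite_set1 a).

(* Main.v *)
Require Import Defs.
From mathcomp Require Import all_boot.
From mathcomp Require Import boolp classical_sets functions cardinality.
Local Open Scope classical_set_scope.

(** Two facts make the finite power algebra of a free algebra free.

    It satisfies the identities.  In a linear term each variable is read once,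
    so choosing an element of the value of each variable and then evaluating
    gives every element of the complex evaluation: the value of a linear term
    [t] at the sets [v x] is the set of the values of [t] at all the points
    [u] with [u x] in [v x] for [x] occurring in [t] ([eval_power]).
    Regularity makes the two sides of an identity quantify over the same
    points [u]; without it, an empty [v x] could kill one side only.

    It has the universal property.  A map [f] from [X] to a 0-semilattice
    ordered algebra [A] extends to a homomorphism [h] from the free algebra to
    the reduct of [A], and the extension to finite sets has to send [B] to the
    finite join of the [h b], [b] in [B], because [B] is the finite union of
    its singletons and singletons form a copy of the free algebra
    ([set_joinE], [sing_hom]).  That this map commutes with operations is the
    point where distributivity enters: an operation of [A] preserves finite
    joins, including the empty one, in each argument, hence sends a tuple of
    joins to the join of the values on all choices of joinands ([opn_dsup]).
    Elements of [A] are compared throughout through their upper bounds. *)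

(** * Complex evaluation of linear terms *)

Section Linear.
Context {S : signature}.
Implicit Types (A : algebra S) (t : term S).

Lemma vars_App (w : S) (ts : 'I_(arity w) -> term S) x :
  vars (App ts) x <-> exists i, vars (ts i) x.
Proof.
rewrite /vars /=; split=> [|[i xi]]; last first.
  by rewrite (bigD1 i) //=; apply: leq_trans xi (leq_addr _ _).
rewrite lt0n sum_nat_eq0 negb_forall => /existsP[i].
by rewrite implyTb -lt0n; exists i.
Qed.

Lemma linear_subterm {w : S} {ts : 'I_(arity w) -> term S} i :
  linear_term (App ts) -> linear_term (ts i).
Proof.
move=> lint x; apply: leq_trans (lint x).
by rewrite /= (bigD1 i) //= leq_addr.
Qed.

Lemma linear_subterm_disjoint {w : S} {ts : 'I_(arity w) -> term S} {i j x} :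
  linear_term (App ts) -> vars (ts i) x -> vars (ts j) x -> i = j.
Proof.
rewrite /vars /= => lint xi xj; apply/eqP; apply: contraT => neq_ij.
have := lint x; rewrite /= (bigD1 i) //= (bigD1 j) /=; last by rewrite eq_sym.
by move: xi xj; case: (occ x (ts i)) => // m; case: (occ x (ts j)) => // n;
  rewrite addSn addnS.
Qed.

Lemma eq_eval A t (u v : nat -> A) :
  (forall x, vars t x -> u x = v x) -> eval u t = eval v t.
Proof.
elim: t => [x|w ts IH] uv /=; first by apply: uv; rewrite /vars /= eqxx.
congr opn; apply/funext => i; apply: IH => x xi.
by apply/uv/vars_App; exists i.
Qed.

(** In a compound linear term the points chosen for the subterms live on
    disjoint sets of variables and can be glued. *)
Lemma eval_power A t (v : nat -> power_algebra A) :
  linear_term t ->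
  sval (eval v t) =
  [set y | exists2 u : nat -> A,
             forall x, vars t x -> sval (v x) (u x) & eval u t = y].
Proof.
elim: t => [x|w ts IH] lint.
  apply/seteqP; split=> y /=.
    by move=> vy; exists (fun=> y) => // z; rewrite /vars /=; case: eqP => // ->.
  by move=> [u uv <-]; apply: uv; rewrite /vars /= eqxx.
have {}IH i := IH i (linear_subterm _ lint).
apply/seteqP; split=> y /= [].
  move=> b bP <-.
  have /choice[u uP] : forall i, exists u : nat -> A,
      (forall x, vars (ts i) x -> sval (v x) (u x)) /\ eval u (ts i) = b i.
    by move=> i; have := bP i; rewrite IH => -[u ? ?]; exists u.
  (* Positive arity provides an index [i0] whose point serves as the default
     value off the variables of the term. *)
  pose i0 := Ordinal (arity_gt0 w).
  pose idx x := odflt i0 [pick i | 0 < occ x (ts i)].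
  have idxE i x : vars (ts i) x -> idx x = i.
    rewrite /idx => xi; case: pickP => [j xj|/(_ i)] /=.
      exact: (linear_subterm_disjoint lint xj xi).
    by move: xi; rewrite /vars /= => ->.
  exists (fun x => u (idx x) x) => [x /vars_App[i xi]|].
    by rewrite (idxE _ _ xi); apply: (uP i).1.
  congr opn; apply/funext => i; rewrite -(uP i).2; apply: eq_eval => x xi.
  by rewrite (idxE _ _ xi).
move=> u uP <-; exists (fun i => eval u (ts i)) => // i.
by rewrite IH; exists u => // x xi; apply/uP/vars_App; exists i.
Qed.

End Linear.

(** * The power algebra is a 0-semilattice ordered algebra *)

Lemma fin_subset_inj (T : Type) : injective (sval : fin_subset T -> set T).
Proof. by move=> [B fB] [C fC] /= BC; apply: eq_exist. Qed.

Section Power.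
Context {S : signature}.
Implicit Types A : algebra S.

Lemma variety_power (E : set (identity S)) A :
  (forall e, E e -> linear_identity e) ->
  (forall e, E e -> regular_identity e) ->
  variety E A -> variety E (power_algebra A).
Proof.
move=> linE regE VA e Ee v; have [lin1 lin2] := linE e Ee.
apply: fin_subset_inj; rewrite !eval_power // -(regE e Ee : vars _ = vars _).
by apply/seteqP; split=> y [u uv <-]; exists u => //; rewrite (VA e Ee).
Qed.

Lemma power_distributive A : distributive_ops (power_algebra A).
Proof.
move=> w a i b; apply: fin_subset_inj; apply/seteqP; split=> y /=.
  move=> [c cP <-]; have := cP i; rewrite /= eqxx /= => -[ci|ci].
    left; exists c => // j; have := cP j => /=.
    by case: eqP => // ->.
  right; exists c => // j; have := cP j => /=.
  by case: eqP => // ->.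
by case=> -[c cP <-]; exists c => // j; have := cP j => /=;
  case: eqP => // ->; [left|right].
Qed.

Lemma power_semilattice_ordered (V : algebra S -> Prop) A :
  V (power_algebra A) -> semilattice_ordered0 V (power_algebra A).
Proof.
move=> VA; split=> //.
- split=> [B C D|B C|B]; apply: fin_subset_inj => /=.
  + exact: setUA.
  + exact: setUC.
  + exact: setUid.
- by move=> B; apply: fin_subset_inj; apply: set0U.
- exact: power_distributive.
- move=> w a i ai0; apply: fin_subset_inj; apply/seteqP; split=> y //= [b bP _].
  by have := bP i; rewrite ai0.
Qed.

Lemma sing_hom A : @is_hom S A (power_algebra A) (@sing S A).
Proof.
move=> w a; apply: fin_subset_inj; apply/seteqP; split=> y /=.
  by move=> ->; exists a.
by move=> [b bP <-]; congr opn; apply/funext => i; apply: bP.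
Qed.

End Power.

(** * Finite joins *)

Section Join.
Context {S : signature} {T : Type}.
Implicit Types (A : algebra0 S) (B : fin_subset T).

Lemma fin_subset_enum_ex B : exists s : seq {classic T}, sval B = [set` s].
Proof. exact/(@finite_seqP {classic T})/(svalP B). Qed.

Definition fin_subset_enum B : seq {classic T} :=
  sval (cid (fin_subset_enum_ex B)).

Lemma fin_subset_enumP B : sval B = [set` fin_subset_enum B].
Proof. exact: (svalP (cid (fin_subset_enum_ex B))). Qed.

Definition list_join {A} (h : T -> A) (s : seq T) : A :=
  foldr (fun b y => add (h b) y) (Defs.zero A) s.

(** An arbitrary enumeration is fixed, so that [additive0_set_join] holds
    without any law on [add]; under the semilattice laws the value does not
    depend on the enumeration, by [set_join_sle] below. *)
Definition set_join {A} (h : T -> A) B : A := list_join h (fin_subset_enum B).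

Definition additive0 {A A' : algebra0 S} (g : A -> A') : Prop :=
  {morph g : x y / add x y} /\ g (Defs.zero A) = Defs.zero A'.

Lemma additive0_set_join {A A' : algebra0 S} {g : A -> A'} (h : T -> A) B :
  additive0 g -> g (set_join h B) = set_join (g \o h) B.
Proof.
move=> [gD g0]; rewrite /set_join.
by elim: (fin_subset_enum B) => //= b s IH; rewrite gD IH.
Qed.

End Join.

Lemma set_joinE (S : signature) (A : algebra S) (B : power_algebra A) :
  B = set_join (@sing S A) B.
Proof.
apply: fin_subset_inj; rewrite {1}fin_subset_enumP /set_join.
elim: (fin_subset_enum B) => [|b s IH] /=.
  by apply/seteqP; split=> y.
rewrite -IH; apply/seteqP; split=> y /=; rewrite inE.
  by move/predU1P.
by move=> yB; apply/predU1P.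
Qed.

(** * Operations preserve finite joins *)

Section Ordered.
Context {S : signature} {V : algebra S -> Prop} {A : algebra0 S}.
Context (KA : semilattice_ordered0 V A).
Implicit Types (x y z : A).

Lemma add_sle x y z : sle (add x y) z <-> sle x z /\ sle y z.
Proof.
case: KA => _ [addA addC addxx] _ _ _; rewrite /sle; split.
  move=> xyz; split; rewrite -xyz.
    by rewrite !addA addxx.
  by rewrite (addC x) !addA addxx.
by move=> [xz yz]; rewrite -addA yz.
Qed.

Lemma sle_inj x y : (forall z, sle x z <-> sle y z) -> x = y.
Proof.
case: KA => _ [_ addC addxx] _ _ _ xy.
have /xy yx : sle x x by apply: addxx.
have /xy : sle y y by apply: addxx.
by rewrite /sle addC yx.
Qed.

Lemma set_join_sle (T : Type) (h : T -> A) (B : fin_subset T) z :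
  sle (set_join h B) z <-> forall b, sval B b -> sle (h b) z.
Proof.
case: KA => _ _ le0 _ _; rewrite fin_subset_enumP /set_join.
elim: (fin_subset_enum B) => [|b s IH] /=; first by split=> // _; apply: le0.
rewrite add_sle IH; split=> [[bz sz] c|bsz].
  by rewrite inE => /predU1P[->|/sz].
by split=> [|c cs]; apply: bsz; rewrite inE ?eqxx // cs orbT.
Qed.

(** The joins that are preserved by every additive self-map: a bare least
    upper bound need not be preserved by the operations of [A]. *)
Definition dsup (P : set A) (y : A) : Prop :=
  forall g : A -> A, additive0 g ->
  forall z, sle (g y) z <-> forall p, P p -> sle (g p) z.

Lemma set_join_dsup (T : Type) (h : T -> A) (B : fin_subset T) :
  dsup (h @` sval B) (set_join h B).
Proof.
move=> g gadd z; rewrite (additive0_set_join _ _ gadd) set_join_sle.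
split=> [Bz _ [b Bb <-]|Bz b Bb]; first exact: Bz.
by apply: Bz; exists b.
Qed.

Lemma opn_additive (w : S) (a : 'I_(arity w) -> A) i :
  additive0 (fun x => opn [eta a with i |-> x] : A).
Proof.
case: KA => _ _ _ dist abs; split=> [x y|].
  have E u : [eta [eta a with i |-> x] with i |-> u] = [eta a with i |-> u]
      :> ('I_(arity w) -> A).
    by apply/funext => j /=; case: eqP.
  by have := dist w [eta a with i |-> x] i y; rewrite E E /= eqxx.
by apply: (abs _ _ i); rewrite /= eqxx.
Qed.

(** The joins are replaced by their joinands one argument at a time,
    in increasing order of the indices, passing through the tuples of [mixed n]
    for n = 0, 1, ...: each replacement is an instance of additivity in that
    argument. *)
Lemma opn_dsup (w : S) (P : 'I_(arity w) -> set A) (y : 'I_(arity w) -> A) z :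
  (forall i, dsup (P i) (y i)) ->
  sle (opn y) z <-> forall p, (forall i, P i (p i)) -> sle (opn p) z.
Proof.
move=> yP.
pose mixed n p :=
  forall i : 'I_(arity w), if i < n then P i (p i) else p i = y i.
suff claim n : n <= arity w ->
    (sle (opn y) z <-> forall p, mixed n p -> sle (opn p) z).
  rewrite (claim _ (leqnn _)); split=> pz p pP; apply: pz => i.
    by rewrite ltn_ord.
  by have := pP i; rewrite ltn_ord.
elim: n => [_|n IH ltnw].
  split=> [yz p p0|]; last by apply.
  by have -> : p = y by apply/funext => i; have := p0 i.
rewrite {}IH ?(ltnW ltnw) //.
pose i := Ordinal ltnw.
have gP p := yP i _ (opn_additive w p i) z.
have set_id p x : p i = x -> [eta p with i |-> x] = p :> ('I_(arity w) -> A).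
  by move=> <-; apply/funext => j /=; case: eqP => // ->.
have ltS j : j != i -> (j < n.+1) = (j < n).
  by move=> ji; rewrite ltnS leq_eqVlt -[n]/(val i) val_eqE (negPf ji).
split=> pz p pP.
  have pi : P i (p i) by have := pP i; rewrite ltnSn.
  rewrite -(set_id p _ erefl); apply: (gP p).1 pi; apply: pz => j /=.
  have [->|ji] := eqVneq j i; first by rewrite ltnn.
  by have := pP j; rewrite ltS.
have pi : p i = y i by have := pP i; rewrite ltnn.
rewrite -(set_id p _ pi); apply: (gP p).2 => q Pq; apply: pz => j /=.
have [->|ji] := eqVneq j i; first by rewrite ltnSn.
by have := pP j; rewrite ltS.
Qed.

Lemma set_join_hom (F : algebra S) (h : F -> A) :
  is_hom h -> is_hom0 (set_join h : power_algebra F -> A).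
Proof.
move=> hhom; split.
- move=> w B; apply: sle_inj => z; rewrite set_join_sle.
  rewrite (opn_dsup _ _ _ _ (fun i => set_join_dsup _ h (B i))).
  split=> [Bz p pP|pz _ [b bB <-]].
    have /choice[b bP] : forall i, exists b, sval (B i) b /\ h b = p i.
      by move=> i; have [b ? ?] := pP i; exists b.
    have -> : p = fun i => h (b i) by apply/funext => i; rewrite (bP i).2.
    by rewrite -hhom; apply: Bz; exists b => // i; apply: (bP i).1.
  by rewrite hhom; apply: pz => i; exists (b i).
- move=> B C; apply: sle_inj => z; rewrite add_sle !set_join_sle /=.
  split=> [BCz|[Bz Cz] b [/Bz|/Cz] //].
  by split=> b bB; apply: BCz; [left|right].
- by apply: sle_inj => z; rewrite set_join_sle /=; case: KA => _ _ le0 _ _; split.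
Qed.

End Ordered.

(** * Freeness *)

Theorem theorem4p12 (S : signature) (E : set (identity S))
    (linE : forall e, E e -> linear_identity e)
    (regE : forall e, E e -> regular_identity e)
    (X : Type) (F : algebra S) (eta : X -> F)
    (freeF : is_free (variety E) eta) :
  is_free0 (semilattice_ordered0 (variety E))
    (fun x : X => sing (eta x) : power_algebra F).
Proof.
have [VF univF] := freeF; split.
  exact/power_semilattice_ordered/variety_power.
move=> A KA f; have [VA _ _ _ _] := KA.
have [h [[hhom heta] huniq]] := univF A VA f.
have join_sing a : set_join h (sing a) = h a.
  apply: (sle_inj KA) => z; rewrite (set_join_sle KA) /=.
  by split=> [|hz b ->] //; apply.
exists (set_join h); split.
  by split=> [|x]; [exact: (set_join_hom KA) | rewrite join_sing].
move=> g [[ghom gD g0] geta].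
have hE : h = g \o @sing S F.
  apply: huniq; split=> // w a.
  by rewrite /= sing_hom ghom.
by apply/funext => B; rewrite {2}(set_joinE _ _ B) additive0_set_join // hE.
Qed.
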